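(* The random variable $F(T_t)$ has density $$\Pr\{F(T_t)\in dx\}/dx=\frac{t}{\pi\sqrt2}\,\frac{t^2+x^2}{t^4+x^4},\qquad x\in\mathbb{R},\ t>0,$$ and this density solves the fourth-order equation $$\left(\frac{\partial^4}{\partial t^4}+\frac{\partial^4}{\partial x^4}\right)u=0.$$
   Context: $B$ is a standard Brownian motion started at $0$ and $T_t=\inf\{s\ge0: B(s)=t\}$ is its first passage time, with density $\frac{t\,e^{-t^2/(2s)}}{\sqrt{2\pi s^3}}$, $s>0$. $F(t)$, $t>0$, is the Fresnel pseudo-process, independent of $B$: its one-dimensional law is the signed measure $$\mu\{F(s)\in dx\}=\frac{dx}{\sqrt{2\pi s}}\cos\left(\frac{x^2}{2s}-\frac{\pi}{4}\right),\qquad x\in\mathbb{R}.$$ The density of the composition $F(T_t)$ is by definition $$\Pr\{F(T_t)\in dx\}/dx=\int_0^\infty\frac{1}{\sqrt{2\pi s}}\cos\left(\frac{x^2}{2s}-\frac{\pi}{4}\right)\frac{t\,e^{-\frac{t^2}{2s}}}{\sqrt{2\pi s^3}}\,ds.$$ *)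

(* Defs.v *)
From HB Require Import structures.
From mathcomp Require Import all_boot all_order all_algebra.
From mathcomp Require Import all_classical all_reals all_analysis.
Import Order.TTheory GRing.Theory Num.Theory.
Import numFieldNormedType.Exports.

Set Implicit Arguments.
Unset Strict Implicit.
Unset Printing Implicit Defensive.

Local Open Scope classical_set_scope.
Local Open Scope ring_scope.

(* One-dimensional law of the Fresnel pseudo-process at time s > 0. It is
   signed and not absolutely integrable in x, so it is kept as a density rather
   than as a charge. *)
Definition fresnel_density (R : realType) (s x : R) : R :=
  (Num.sqrt (2 * pi * s))^-1 * cos (x ^+ 2 / (2 * s) - pi / 4).

(* Density in s > 0 of the first passage time at level t > 0 of a standard
   Brownian motion started at 0. *)
Definition passage_density (R : realType) (t s : R) : R :=
  t * expR (- (t ^+ 2 / (2 * s))) / Num.sqrt (2 * pi * s ^+ 3).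

Definition composition_integrand (R : realType) (t x s : R) : R :=
  fresnel_density s x * passage_density t s.

(* Density at x of F(T_t), by definition of the composition. *)
Definition composition_density (R : realType) (t x : R) : R :=
  Rintegral (@lebesgue_measure R) `]0, +oo[ (composition_integrand t x).

(* derive1n is total: this says that its first n iterates at x are genuine
   derivatives. *)
Definition derivable_upto (R : realType) (n : nat) (f : R -> R) (x : R) : Prop :=
  forall k : nat, (k < n)%N -> derivable (derive1n k f) x 1.

(* Main.v *)
Require Import Defs.
From mathcomp Require Import all_boot all_order all_algebra.
From mathcomp Require Import all_classical all_reals all_analysis.
From mathcomp Require Import measurable_realfun ring lra.
Import Order.TTheory GRing.Theory Num.Theory.
Import numFieldNormedType.Exports.
Local Open Scope classical_set_scope.
Local Open Scope ring_scope.

(** The density is elementary because the substitution [u = 1 / s] turns the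
    mixture into a Laplace transform.  The two normalising square roots multiply
    to [2 * pi * s ^+ 2], and [s ^- 2 ds] is, up to sign, [du], so

      density = t / (2 pi) * int_0^oo exp (- a u) cos (b u - pi / 4) du

    with [a = t ^+ 2 / 2] and [b = x ^+ 2 / 2].  This integral is
    [(a cos (pi / 4) + b sin (pi / 4)) / (a ^+ 2 + b ^+ 2)], which is the stated
    rational function since both trigonometric values are [1 / sqrt 2].  The
    substitution is never performed: the elementary primitive in [u], composed
    with inversion, is a primitive in [s], and the fundamental theorem of
    calculus on the half-line applies ([integral_laplace_phaseV]).  Its version
    for nonnegative functions is extended to signed ones by adding an integrable
    majorant that has a primitive too ([dominated_FTC2_obndy]); here the
    majorant is [s ^- 2 * exp (- a / s)], which also gives absolute convergence.

    The density solves the equation for the following reason.  As a rational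
    function of [t] it has, for [x] nonzero, simple poles at the four points
    [w * x] with [w ^+ 4 = -1], and its residues there do not depend on [x].
    It is therefore a combination, with constant coefficients, of the functions
    [1 / (t - w * x)], and each of them satisfies
    [d_x^4 = w ^+ 4 * d_t^4 = - d_t^4].  Over the reals this is checked without
    the complex poles: the [k]-th derivative of [p / q] is a polynomial over
    [q ^+ k.+1] ([derive1n_quotient]), the denominator [t ^+ 4 + x ^+ 4] is the
    same in both variables, and the two numerators at [k = 4] are opposite
    ([quartic_numer_cancel]). *)

(** * The fundamental theorem of calculus on a half-line *)
Section half_line.
Set Implicit Arguments.
Unset Strict Implicit.
Context {R : realType}.
Implicit Types (f g F G : R -> R) (a c l m L M : R).
Local Notation mu := (@lebesgue_measure R).

(** Only one-sided limits at [a] are required, so that [f] and [F] may take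
    arbitrary values there, as expressions in [s^-1] do at [s = 0].  Both are
    patched by their limits to reach the version for closed half-lines. *)
Lemma ge0_FTC2_obndy f F a c m l :
  (forall s, a < s -> 0 <= f s) ->
  (forall s, a < s -> {for s, continuous f}) -> f s @[s --> a^'+] --> c ->
  (forall s, a < s -> is_derive s 1 F (f s)) ->
  F s @[s --> a^'+] --> m -> F s @[s --> +oo] --> l ->
  (\int[mu]_(s in `]a, +oo[) (f s)%:E)%E = (l - m)%:E.
Proof.
move=> f0 fc fa dF Fa Fl.
pose patch v (h : R -> R) := fun s => if s <= a then v else h s.
have patchE v h s : a < s -> patch v h s = h s.
  by move=> ?; rewrite /patch leNgt; case: ltP => //; rewrite leNgt => /negP.
have paE v h : patch v h a = v by rewrite /patch lexx.
have near_patch v h s : a < s -> \forall z \near s, h z = patch v h z.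
  by move=> /lt_nbhsr; apply: filterS => z az; rewrite patchE.
have right_patch v h w : h s @[s --> a^'+] --> w ->
    patch v h s @[s --> a^'+] --> w.
  apply: cvg_trans; apply: near_eq_cvg; near=> z.
  by rewrite patchE//; near: z; exact: nbhs_right_gt.
have cc : 0 <= c.
  apply: (cvgr_to_ge fa).
  by near=> z; apply: f0; near: z; exact: nbhs_right_gt.
have mf : measurable_fun `]a, +oo[ f.
  apply: open_continuous_measurable_fun; first exact: interval_open.
  by move=> s; rewrite inE /= in_itv/= andbT => /fc.
transitivity (\int[mu]_(s in `[a, +oo[) (patch c f s)%:E)%E.
  have E : {in `]a, +oo[%classic, f =1 patch c f}.
    by move=> s; rewrite inE/= in_itv/= andbT => ?; rewrite patchE.
  rewrite -integral_itv_obnd_cbnd; last first.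
    apply/measurable_EFinP; exact: eq_measurable_fun mf.
  by apply: eq_integral => s /E ->.
rewrite (@ge0_continuous_FTC2y _ (patch c f) (patch m F) a l).
- by rewrite paE EFinB.
- by move=> s _; rewrite /patch; case: (leP s a) => [_|/f0 //].
- apply/continuous_within_itvcyP; split.
    move=> s; rewrite in_itv/= andbT => als; have := fc _ als.
    rewrite /prop_for /continuous_at patchE//.
    by apply: cvg_trans; apply: near_eq_cvg; exact: near_patch.
  by rewrite paE; exact: right_patch.
- apply: cvg_trans Fl; apply: near_eq_cvg; near=> z.
  by rewrite patchE//; near: z; apply: nbhs_pinfty_gt; exact: num_real.
- move=> s als; have [dFs _] := dF _ als.
  exact: near_eq_derivable (near_patch m F _ als) dFs.
- by rewrite paE; exact: right_patch.
- move=> s; rewrite in_itv/= andbT => als; rewrite derive1E patchE//.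
  rewrite -(near_eq_derive _ (near_patch m F _ als)).
  by have [_ ->] := dF _ als.
Unshelve. all: by end_near. Qed.

(** The absence of a sign condition on [f] is repaired by the majorant: both
    [g] and [f + g] are nonnegative with a known primitive. *)
Lemma dominated_FTC2_obndy f g F G a c l m L M :
  (forall s, a < s -> `|f s| <= g s) ->
  (forall s, a < s -> {for s, continuous f}) ->
  (forall s, a < s -> {for s, continuous g}) ->
  f s @[s --> a^'+] --> c ->
  (forall s, a < s -> is_derive s 1 F (f s)) ->
  F s @[s --> a^'+] --> m -> F s @[s --> +oo] --> l ->
  cvg (g s @[s --> a^'+]) ->
  (forall s, a < s -> is_derive s 1 G (g s)) ->
  G s @[s --> a^'+] --> M -> G s @[s --> +oo] --> L ->
  mu.-integrable `]a, +oo[ (EFin \o f) /\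
  (\int[mu]_(s in `]a, +oo[) f s)%R = l - m.
Proof.
move=> fg fc gc fa dF Fa Fl /cvg_ex[d ga] dG Ga Gl.
have g0 s : a < s -> 0 <= g s by move=> /fg; apply: le_trans.
have mR (h : R -> R) : (forall s, a < s -> {for s, continuous h}) ->
    measurable_fun `]a, +oo[ h.
  move=> hc; apply: open_continuous_measurable_fun; first exact: interval_open.
  by move=> s; rewrite inE /= in_itv/= andbT => /hc.
have mI : measurable (`]a, +oo[%classic : set R) by [].
have intgE := ge0_FTC2_obndy g0 gc ga dG Ga Gl.
have intg : mu.-integrable `]a, +oo[ (EFin \o g).
  apply/integrableP; split; first by apply/measurable_EFinP; apply: mR.
  rewrite [ltLHS](_ : _ = (L - M)%:E) ?ltry // -intgE.
  apply: eq_integral => s; rewrite inE/= in_itv/= andbT => als.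
  by rewrite /= ger0_norm// g0.
have intf : mu.-integrable `]a, +oo[ (EFin \o f).
  apply: le_integrable intg => //; first by apply/measurable_EFinP; apply: mR.
  move=> s /=; rewrite in_itv/= andbT => als.
  by rewrite lee_fin (ger0_norm (g0 _ als)) fg.
split=> //.
have fgE : (\int[mu]_(s in `]a, +oo[) (f s + g s)%:E)%E
    = ((l + L) - (m + M))%:E.
  apply: (@ge0_FTC2_obndy _ (F + G) a (c + d)).
  - by move=> s /fg; rewrite ler_norml => /andP[]; lra.
  - by move=> s als; apply: continuousD; [exact: fc|exact: gc].
  - exact: cvgD.
  - by move=> s als; apply: is_deriveD; [exact: dF|exact: dG].
  - exact: cvgD.
  - exact: cvgD.
have := @RintegralD _ _ R mu _ f g mI intf intg.
rewrite {1}/Rintegral fgE /= [X in _ = _ + X]/Rintegral intgE /=; lra.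
Qed.

End half_line.

(** * A Laplace transform after inversion *)
Section laplace.
Set Implicit Arguments.
Unset Strict Implicit.
Context {R : realType}.
Implicit Types (a b theta s u : R).

(** The factor [u ^+ 2] is the Jacobian of [u = s^-1]: what gets integrated in
    [s] is [laplace_phase a b theta s^-1]. *)
Definition laplace_phase a b theta u : R :=
  u ^+ 2 * expR (- (a * u)) * cos (b * u - theta).

(** Up to the factor [- (a ^+ 2 + b ^+ 2)^-1], a primitive in [u] of
    [expR (- (a * u)) * cos (b * u - theta)]: the real part of the complex
    exponential [exp ((- a + i b) u - i theta)] divided by its rate. *)
Definition laplace_phase_primitive a b theta u : R :=
  expR (- (a * u)) * (a * cos (b * u - theta) - b * sin (b * u - theta)).

Lemma is_derive_laplace_phase_primitive a b theta u :
  is_derive u 1 (laplace_phase_primitive a b theta)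
    (- ((a ^+ 2 + b ^+ 2) * (expR (- (a * u)) * cos (b * u - theta)))).
Proof.
have dE : is_derive u 1 (fun v => expR (- (a * v))) (expR (- (a * u)) * (- a)).
  apply: (@is_derive1_comp R expR (fun v => - (a * v))).
  by apply: is_derive_eq; rewrite /GRing.scale/= !(mulr0, mul0r, mulr1, addr0).
have dP : is_derive u 1 (fun v => b * v - theta) b.
  by apply: is_derive_eq; rewrite /GRing.scale/= !(mulr0, mul0r, mulr1, addr0, subr0).
have dC : is_derive u 1 (fun v => cos (b * v - theta)) (- sin (b * u - theta) * b).
  exact: (@is_derive1_comp R cos _ u _ _ _ dP).
have dS : is_derive u 1 (fun v => sin (b * v - theta)) (cos (b * u - theta) * b).
  exact: (@is_derive1_comp R sin _ u _ _ _ dP).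
rewrite /laplace_phase_primitive.
apply: is_derive_eq; rewrite /GRing.scale/=; ring.
Qed.

Lemma is_derive_inv s : s != 0 -> is_derive s 1 (@GRing.inv R) (- (s^-1 ^+ 2)).
Proof.
move=> s0; have := @is_deriveV R id s 1 1 s0 (is_derive_id s 1).
by rewrite /GRing.scale /= mulr1 exprVn.
Qed.

Lemma continuous_laplace_phase a b theta : continuous (laplace_phase a b theta).
Proof.
move=> u; have cl k : k * v @[v --> u] --> k * u.
  by apply: cvgM; [exact: cvg_cst|exact: cvg_id].
rewrite /continuous_at /laplace_phase; apply: cvgM; last first.
  apply: continuous_cvg; first exact: continuous_cos.
  by apply: cvgB; [exact: cl|exact: cvg_cst].
apply: cvgM; first exact: exprn_continuous.
by apply: continuous_cvg; [exact: continuous_expR|apply: cvgN; exact: cl].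
Qed.

(** Exponential decay beats any power of [s^-1] with a factor [s] to spare: this
    linear bound gives all the limits at [0] below.  It comes from the single
    term of order [n.+1] in the series of [expR (a * s^-1)]. *)
Lemma expn_expRN_le a n s : 0 < a -> 0 < s ->
  s^-1 ^+ n * expR (- (a * s^-1)) <= n.+1`!%:R / a ^+ n.+1 * s.
Proof.
move=> a0 s0; have y0 : 0 < a * s^-1 by rewrite mulr_gt0 ?invr_gt0.
have h : (a * s^-1) ^+ n.+1 / n.+1`!%:R <= expR (a * s^-1).
  by apply: le_trans (expR_ge1Dxn n (ltW y0)); rewrite lerDr.
rewrite expRN ler_pdivrMr ?expR_gt0//.
have F0 : 0 < n.+1`!%:R :> R by rewrite ltr0n fact_gt0.
have -> : s^-1 ^+ n = n.+1`!%:R / a ^+ n.+1 * s * ((a * s^-1) ^+ n.+1 / n.+1`!%:R).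
  have an : a ^+ n != 0 by rewrite expf_neq0 ?gt_eqF.
  rewrite exprMn !exprS; move: (a ^+ n) an => A an; field.
  by rewrite an !gt_eqF.
by rewrite ler_pM2l// !mulr_gt0 ?invr_gt0 ?exprn_gt0.
Qed.

Lemma cvg_at_right0_bound (h : R -> R) (K : R) :
  (forall s, 0 < s -> `|h s| <= K * s) -> h s @[s --> 0^'+] --> 0.
Proof.
move=> hK.
have cK : K * s @[s --> 0^'+] --> 0.
  rewrite -[X in _ --> X](mulr0 K); apply: cvg_at_right_filter.
  by apply: cvgM; [exact: cvg_cst|exact: cvg_id].
apply: (@squeeze_cvgr _ _ _ _ (fun s => - (K * s)) (fun s => K * s)) => //; last first.
  by rewrite -[X in _ --> X]oppr0; exact: cvgN.
near=> s; rewrite -ler_norml; apply: hK.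
by near: s; exact: nbhs_right_gt.
Unshelve. all: by end_near. Qed.

Lemma laplace_phaseV_bound a b theta s : 0 < a -> 0 < s ->
  `|laplace_phase a b theta s^-1| <= laplace_phase a 0 0 s^-1.
Proof.
move=> a0 s0; have h0 : 0 <= s^-1 ^+ 2 * expR (- (a * s^-1)).
  by rewrite mulr_ge0 ?expR_ge0// exprn_ge0 ?invr_ge0 ?ltW.
rewrite /laplace_phase normrM (ger0_norm h0) mul0r subrr cos0.
by rewrite ler_wpM2l ?cos_max.
Qed.

Lemma laplace_phaseV_cvg0 a b theta : 0 < a ->
  laplace_phase a b theta s^-1 @[s --> 0^'+] --> 0.
Proof.
move=> a0; apply: (@cvg_at_right0_bound _ (3`!%:R / a ^+ 3)) => s s0.
apply: le_trans (laplace_phaseV_bound _ _ a0 s0) _.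
by rewrite /laplace_phase mul0r subrr cos0 mulr1 expn_expRN_le.
Qed.

Lemma laplace_phase_primitiveV_cvg0 a b theta : 0 < a ->
  laplace_phase_primitive a b theta s^-1 @[s --> 0^'+] --> 0.
Proof.
move=> a0; apply: (@cvg_at_right0_bound _ ((a + `|b|) * (1`!%:R / a ^+ 1))) => s s0.
rewrite /laplace_phase_primitive normrM ger0_norm ?expR_ge0// mulrC -mulrA.
apply: ler_pM; rewrite ?expR_ge0//.
  apply: le_trans (ler_normB _ _) _; rewrite !normrM gtr0_norm//.
  apply: lerD; first by rewrite ler_piMr ?cos_max ?ltW.
  by rewrite ler_piMr ?sin_max.
by have := expn_expRN_le 0 a0 s0; rewrite expr0 mul1r.
Qed.

Lemma laplace_phase_primitiveV_cvgy a b theta :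
  laplace_phase_primitive a b theta s^-1 @[s --> +oo] -->
  a * cos theta + b * sin theta.
Proof.
have -> : a * cos theta + b * sin theta = laplace_phase_primitive a b theta 0.
  by rewrite /laplace_phase_primitive !mulr0 oppr0 expR0 sub0r cosN sinN; ring.
have c0 : {for 0, continuous (laplace_phase_primitive a b theta)}.
  apply: differentiable_continuous; apply/derivable1_diffP.
  by have [] := is_derive_laplace_phase_primitive a b theta 0.
have V0 : (s : R)^-1 @[s --> +oo] --> 0.
  apply/(@gtr0_cvgV0 _ _ _ _ id); last exact: cvg_id.
  by apply: nbhs_pinfty_gt; exact: num_real.
exact: cvg_comp V0 c0.
Qed.

Lemma is_derive_laplace_phase_primitiveV a b theta s : 0 < a -> 0 < s ->
  is_derive s 1
    (fun s => (a ^+ 2 + b ^+ 2)^-1 * laplace_phase_primitive a b theta s^-1)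
    (laplace_phase a b theta s^-1).
Proof.
move=> a0 s0; have n0 : a ^+ 2 + b ^+ 2 != 0.
  by rewrite gt_eqF// ltr_wpDr ?sqr_ge0 ?exprn_gt0.
have dV := is_derive_inv (lt0r_neq0 s0).
have dP := is_derive_laplace_phase_primitive a b theta s^-1.
have dc := @is_derive1_comp R _ _ _ _ _ dP dV.
have dk := @is_deriveZ _ _ _ _ (a ^+ 2 + b ^+ 2)^-1 _ _ _ dc.
apply: (is_derive_eq dk); rewrite /GRing.scale /= /laplace_phase.
by move: (a ^+ 2 + b ^+ 2) (s^-1) n0 => N u n0; field.
Qed.

(** The value is the contribution of the primitive at [s = +oo], that is at
    [u = 0]; nothing comes from [s = 0].  The majorant is the same integrand
    with no oscillation, [b = theta = 0]. *)
Lemma integral_laplace_phaseV a b theta : 0 < a ->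
  (@lebesgue_measure R).-integrable `]0, +oo[
    (fun s => (laplace_phase a b theta s^-1)%:E) /\
  Rintegral (@lebesgue_measure R) `]0, +oo[
    (fun s => laplace_phase a b theta s^-1) =
  (a * cos theta + b * sin theta) / (a ^+ 2 + b ^+ 2).
Proof.
move=> a0; set k := (a ^+ 2 + b ^+ 2)^-1; set k0 := (a ^+ 2 + 0 ^+ 2)^-1.
have cV b' th s : 0 < s ->
    {for s, continuous (fun r : R => laplace_phase a b' th r^-1)}.
  move=> s0; apply: continuous_cvg; first exact: continuous_laplace_phase.
  by apply: inv_continuous; rewrite gt_eqF.
have H0 b' th v : v * laplace_phase_primitive a b' th s^-1 @[s --> 0^'+] --> 0.
  rewrite -[X in _ --> X](mulr0 v); apply: cvgM; first exact: cvg_cst.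
  exact: laplace_phase_primitiveV_cvg0.
have Hy b' th v : v * laplace_phase_primitive a b' th s^-1 @[s --> +oo] -->
    v * (a * cos th + b' * sin th).
  by apply: cvgM; [exact: cvg_cst|exact: laplace_phase_primitiveV_cvgy].
have := @dominated_FTC2_obndy R
  (fun s => laplace_phase a b theta s^-1) (fun s => laplace_phase a 0 0 s^-1)
  (fun s => k * laplace_phase_primitive a b theta s^-1)
  (fun s => k0 * laplace_phase_primitive a 0 0 s^-1)
  0 0 _ _ _ _
  (fun s => laplace_phaseV_bound b theta a0) (cV b theta) (cV 0 0)
  (laplace_phaseV_cvg0 _ _ a0) (fun s => is_derive_laplace_phase_primitiveV b theta a0)
  (H0 b theta k) (Hy b theta k) (cvgP _ (laplace_phaseV_cvg0 0 0 a0))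
  (fun s => is_derive_laplace_phase_primitiveV 0 0 a0) (H0 0 0 k0) (Hy 0 0 k0).
by case=> intf ->; split=> //; rewrite subr0 mulrC.
Qed.

End laplace.

(** * Iterated derivatives of rational functions *)
Section quotient.
Set Implicit Arguments.
Unset Strict Implicit.
Context {R : realType}.
Implicit Types (p q : {poly R}).

(** Numerators over [q ^+ k.+1], rather than reduced fractions: the recursion
    then stays within polynomials, and numerators for two quotients with equal
    denominators can be compared directly. *)
Fixpoint quotient_numer p q k : {poly R} :=
  if k is j.+1 then
    (quotient_numer p q j)^`() * q - (quotient_numer p q j * q^`()) *+ k
  else p.

Lemma is_derive_quotient p q m (x : R) : q.[x] != 0 ->
  is_derive x 1 (fun y => p.[y] / q.[y] ^+ m)
    ((p^`() * q - (p * q^`()) *+ m).[x] / q.[x] ^+ m.+1).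
Proof.
move=> qx; have qmx : (fun y => q.[y] ^+ m) x != 0 by rewrite expf_neq0.
have dqm : is_derive x 1 (fun y => q.[y] ^+ m) (m%:R * q.[x] ^+ m.-1 * q^`().[x]).
  have -> : (fun y => q.[y] ^+ m) = (horner q) ^+ m.
    by apply/funext => y; rewrite exprfctE.
  exact: is_deriveX.
have dV := @is_deriveV _ (fun y => q.[y] ^+ m) x _ 1 qmx dqm.
apply: is_derive_eq.
rewrite /GRing.scale /= hornerD hornerN hornerMn !hornerM.
case: m {qmx dqm dV} => [|m]; last first.
  have := expf_neq0 m qx; rewrite /= -mulr_natr !exprS.
  by move: (q.[x] ^+ m) => u u0; field; rewrite qx u0.
by rewrite /= !(mul0r, mulr0) add0r mulr0n subr0 expr0 expr1 invr1 mul1r mulfK.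
Qed.

(** Agreement on an open set is enough because the identity for the [k]-th
    derivative again holds on all of that set and can be differentiated. *)
Lemma derive1n_quotient p q (f : R -> R) (A : set R) : open A ->
    (forall y, A y -> q.[y] != 0) ->
    (forall y, A y -> f y = p.[y] / q.[y]) ->
  forall k y, A y -> derivable (derive1n k f) y 1 /\
    derive1n k f y = (quotient_numer p q k).[y] / q.[y] ^+ k.+1.
Proof.
move=> oA q0 fE.
have step h k : (forall y, A y -> h y = (quotient_numer p q k).[y] / q.[y] ^+ k.+1) ->
    forall y, A y -> derivable h y 1 /\
    derive1 h y = (quotient_numer p q k.+1).[y] / q.[y] ^+ k.+2.
  move=> hE y Ay.
  have near_h : \forall z \near y, (quotient_numer p q k).[z] / q.[z] ^+ k.+1 = h z.
    by move: (open_nbhs_nbhs (conj oA Ay)); apply: filterS => z /hE ->.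
  have dq := is_derive_quotient (quotient_numer p q k) k.+1 (q0 y Ay).
  have [dh dhE] := near_eq_is_derive near_h dq.
  by split=> //; rewrite derive1E dhE.
move=> k; elim: k => [|k IH] y Ay.
  have fE0 z : A z -> f z = (quotient_numer p q 0).[z] / q.[z] ^+ 1.
    by rewrite expr1; exact: fE.
  by split; [have [] := step f 0 fE0 y Ay | exact: fE0].
have [_ E] := step _ k (fun z Az => (IH z Az).2) y Ay.
have E' z : A z -> derive1n k.+1 f z = (quotient_numer p q k.+1).[z] / q.[z] ^+ k.+2.
  by move=> Az; have [_ <-] := step _ k (fun z Az => (IH z Az).2) z Az.
split; last exact: E'.
by have [] := step _ k.+1 E' y Ay.
Qed.

(** Leibniz rule for [p * q^-1], whose coefficients are [q ^+ 5] times the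
    derivatives of [q^-1].  The numerators of orders 2 and 3 are normalised on
    the way, which keeps the polynomial identities small. *)
Lemma quotient_numer4E p q :
  quotient_numer p q 4 =
    p^`()^`()^`()^`() * q ^+ 4
    - p^`()^`()^`() * (q^`() * q ^+ 3) *+ 4
    - p^`()^`() * (q^`()^`() * q ^+ 3 - q^`() ^+ 2 * q ^+ 2 *+ 2) *+ 6
    - p^`() * (q^`()^`()^`() * q ^+ 3 - q^`() * q^`()^`() * q ^+ 2 *+ 6
               + q^`() ^+ 3 * q *+ 6) *+ 4
    - p * (q^`()^`()^`()^`() * q ^+ 3 - q^`() * q^`()^`()^`() * q ^+ 2 *+ 8
           - q^`()^`() ^+ 2 * q ^+ 2 *+ 6 + q^`() ^+ 2 * q^`()^`() * q *+ 36
           - q^`() ^+ 4 *+ 24).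
Proof.
have N1 : quotient_numer p q 1 = p^`() * q - p * q^`() by [].
have N2 : quotient_numer p q 2 = p^`()^`() * q ^+ 2 - p^`() * q^`() * q *+ 2
    - p * (q^`()^`() * q - q^`() ^+ 2 *+ 2).
  rewrite [LHS]/= -/(quotient_numer p q 1) N1 !(derivB, derivD, derivM, derivMn, derivN).
  ring.
have N3 : quotient_numer p q 3 = p^`()^`()^`() * q ^+ 3
    - p^`()^`() * q^`() * q ^+ 2 *+ 3
    - p^`() * (q^`()^`() * q ^+ 2 - q^`() ^+ 2 * q *+ 2) *+ 3
    - p * (q^`()^`()^`() * q ^+ 2 - q^`() * q^`()^`() * q *+ 6 + q^`() ^+ 3 *+ 6).
  rewrite -[LHS]/((quotient_numer p q 2)^`() * q - (quotient_numer p q 2 * q^`()) *+ 3).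
  rewrite N2 !expr2 !(derivB, derivD, derivM, derivMn, derivN).
  ring.
rewrite -[LHS]/((quotient_numer p q 3)^`() * q - (quotient_numer p q 3 * q^`()) *+ 4).
rewrite N3 !expr2 !exprS expr0 !mulr1 !(derivB, derivD, derivM, derivMn, derivN).
ring.
Qed.

Lemma horner_quotient_numer4 p q (y : R) :
  let: (p0, p1, p2, p3, p4) := (p.[y], p^`().[y], p^`()^`().[y],
    p^`()^`()^`().[y], p^`()^`()^`()^`().[y]) in
  let: (q0, q1, q2, q3, q4) := (q.[y], q^`().[y], q^`()^`().[y],
    q^`()^`()^`().[y], q^`()^`()^`()^`().[y]) in
  (quotient_numer p q 4).[y] =
    p4 * q0 ^+ 4
    - p3 * (q1 * q0 ^+ 3) *+ 4
    - p2 * (q2 * q0 ^+ 3 - q1 ^+ 2 * q0 ^+ 2 *+ 2) *+ 6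
    - p1 * (q3 * q0 ^+ 3 - q1 * q2 * q0 ^+ 2 *+ 6 + q1 ^+ 3 * q0 *+ 6) *+ 4
    - p0 * (q4 * q0 ^+ 3 - q1 * q3 * q0 ^+ 2 *+ 8 - q2 ^+ 2 * q0 ^+ 2 *+ 6
            + q1 ^+ 2 * q2 * q0 *+ 36 - q1 ^+ 4 *+ 24).
Proof.
(* horner_eval y is a registered ring morphism, which ring distributes *)
rewrite quotient_numer4E -!horner_evalE.
ring.
Qed.

(** The fourth-order equation once denominators are cleared: both quotients are
    [c * t * (t ^+ 2 + x ^+ 2) / (t ^+ 4 + x ^+ 4)], read as a function of [t]
    on the left and of [x] on the right. *)
Lemma quartic_numer_cancel (t x c : R) :
  (quotient_numer (c *: ('X^3 + x ^+ 2 *: 'X)) ('X^4 + (x ^+ 4)%:P) 4).[t] +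
  (quotient_numer (c *: ((t ^+ 3)%:P + t *: 'X^2)) ('X^4 + (t ^+ 4)%:P) 4).[x] = 0.
Proof.
rewrite !horner_quotient_numer4 !(derivZ, derivD, derivC, derivMn, derivXn, derivX).
rewrite !(hornerZ, hornerD, hornerC, hornerMn, hornerXn, hornerX).
ring.
Qed.
End quotient.

(** * The density of the composition *)
Section density.
Set Implicit Arguments.
Unset Strict Implicit.
Context {R : realType}.
Implicit Types (t x s : R).

Lemma cos_piquarter : cos (pi / 4) = (Num.sqrt 2)^-1 :> R.
Proof.
have E : pi / 4 - pi / 2 = - (pi / 4) :> R by field.
have cs : cos (pi / 4) = sin (pi / 4) :> R by rewrite -cosBpihalf E cosN.
have c0 : 0 < cos (pi / 4) :> R.
  by apply: cos_gt0_pihalf; have := pi_gt0 R; lra.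
have s0 : 0 < Num.sqrt 2 :> R by rewrite sqrtr_gt0.
apply: (mulIf (lt0r_neq0 s0)); rewrite mulVf ?lt0r_neq0//.
apply/eqP; rewrite -(@sqrp_eq1 _ (cos (pi / 4) * _)) ?mulr_ge0 ?ltW//.
have := cos2Dsin2 (pi / 4 : R).
by rewrite -cs exprMn sqr_sqrtr// mulr_natr mulr2n => ->.
Qed.

Lemma sin_piquarter : sin (pi / 4) = (Num.sqrt 2)^-1 :> R.
Proof.
have E : pi / 4 - pi / 2 = - (pi / 4) :> R by field.
by rewrite -cos_piquarter -cosBpihalf E cosN.
Qed.

(** The square roots of [2 * pi * s] and [2 * pi * s ^+ 3] multiply to a perfect
    square, which is what makes the integrand elementary in [s^-1]. *)
Lemma composition_integrandE t x s : 0 < s ->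
  composition_integrand t x s =
  t / (2 * pi) * laplace_phase (t ^+ 2 / 2) (x ^+ 2 / 2) (pi / 4) s^-1.
Proof.
move=> s0; have pi0 := pi_gt0 R.
rewrite /composition_integrand /fresnel_density /passage_density /laplace_phase.
have halve y : y / (2 * s) = y / 2 / s :> R by rewrite invfM mulrA.
rewrite !halve.
have sE : (Num.sqrt (2 * pi * s))^-1 * (Num.sqrt (2 * pi * s ^+ 3))^-1 =
    (2 * pi * s ^+ 2)^-1 :> R.
  rewrite -invfM -sqrtrM; last by rewrite !mulr_ge0// ltW.
  rewrite (_ : 2 * pi * s * (2 * pi * s ^+ 3) = (2 * pi * s ^+ 2) ^+ 2); last by ring.
  by rewrite sqrtr_sqr ger0_norm// !mulr_ge0 ?exprn_ge0// ltW.
set u := (Num.sqrt _)^-1 in sE *; set v := (Num.sqrt _)^-1 in sE *.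
set C := cos _; set E := expR _.
transitivity (u * v * (C * t * E)); first by ring.
rewrite sE; move: C E (pi : R) pi0 => C E q q0; field.
by rewrite !gt_eqF.
Qed.

Lemma composition_density_closed_form t x : 0 < t ->
  (@lebesgue_measure R).-integrable `]0, +oo[
     (fun s : R => (composition_integrand t x s)%:E) /\
  composition_density t x =
    t / (pi * Num.sqrt 2) * ((t ^+ 2 + x ^+ 2) / (t ^+ 4 + x ^+ 4)).
Proof.
move=> t0; have a0 : 0 < t ^+ 2 / 2 by rewrite divr_gt0 ?exprn_gt0.
have [intL LE] := integral_laplace_phaseV (x ^+ 2 / 2) (pi / 4) a0.
have E : {in `]0, +oo[%classic, forall s, composition_integrand t x s =
    t / (2 * pi) * laplace_phase (t ^+ 2 / 2) (x ^+ 2 / 2) (pi / 4) s^-1}.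
  by move=> s; rewrite inE/= in_itv/= andbT => /composition_integrandE.
split.
  apply: (eq_integrable _ _ _ _ (integrableZl _ (t / (2 * pi)) intL)) => //.
  by move=> s /E ->; rewrite EFinM.
transitivity (Rintegral (@lebesgue_measure R) `]0, +oo[ (fun s => t / (2 * pi) *
    laplace_phase (t ^+ 2 / 2) (x ^+ 2 / 2) (pi / 4) s^-1)).
  by apply: eq_Rintegral => s /E.
rewrite RintegralZl// LE cos_piquarter sin_piquarter.
have s0 : 0 < Num.sqrt 2 :> R by rewrite sqrtr_gt0.
have q0 : 0 < t ^+ 4 + x ^+ 4.
  by rewrite ltr_pwDl ?exprn_gt0// exprn_even_ge0.
have pi0 := pi_gt0 R.
move: (Num.sqrt 2) s0 (pi : R) pi0 => r r0 p p0; field.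
by rewrite !gt_eqF.
Qed.
End density.

Theorem theorem6p2 (R : realType) (t x : R) (ht : 0 < t) :
  (* the integral defining the density converges absolutely *)
  (@lebesgue_measure R).-integrable `]0, +oo[
     (fun s : R => (composition_integrand t x s)%:E) /\
  composition_density t x =
    t / (pi * Num.sqrt 2) * ((t ^+ 2 + x ^+ 2) / (t ^+ 4 + x ^+ 4)) /\
  derivable_upto 4 (fun t' : R => composition_density t' x) t /\
  derivable_upto 4 (fun x' : R => composition_density t x') x /\
  derive1n 4 (fun t' : R => composition_density t' x) t +
    derive1n 4 (fun x' : R => composition_density t x') x = 0.
Proof.
have [int_tx densE] := composition_density_closed_form x ht.
pose c : R := (pi * Num.sqrt 2)^-1.
have q0 (y z : R) : 0 < y -> y ^+ 4 + z ^+ 4 != 0.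
  by move=> y0; rewrite gt_eqF// ltr_pwDl ?exprn_gt0// exprn_even_ge0.
have quotE (y z : R) : 0 < y -> composition_density y z =
    c * (y ^+ 3 + y * z ^+ 2) / (y ^+ 4 + z ^+ 4).
  move=> y0; have [_ ->] := composition_density_closed_form z y0.
  by rewrite -/c; ring.
have Dt := @derive1n_quotient R (c *: ('X^3 + x ^+ 2 *: 'X))
  ('X^4 + (x ^+ 4)%:P) (fun t' => composition_density t' x) _ (@open_gt R 0).
have Dx := @derive1n_quotient R (c *: ((t ^+ 3)%:P + t *: 'X^2))
  ('X^4 + (t ^+ 4)%:P) (fun x' => composition_density t x') _ openT.
have {}Dt k : derivable (derive1n k (fun t' => composition_density t' x)) t 1 /\
    derive1n k (fun t' => composition_density t' x) t =
    (quotient_numer (c *: ('X^3 + x ^+ 2 *: 'X)) ('X^4 + (x ^+ 4)%:P) k).[t] /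
      (t ^+ 4 + x ^+ 4) ^+ k.+1.
  have -> : t ^+ 4 + x ^+ 4 = ('X^4 + (x ^+ 4)%:P).[t].
    by rewrite hornerD hornerXn hornerC.
  apply: (Dt _ _ k t ht) => y y0; rewrite (hornerD 'X^4) hornerXn hornerC; first exact: q0.
  rewrite quotE// hornerZ hornerD hornerXn hornerZ hornerX.
  by rewrite (mulrC y).
have {}Dx k : derivable (derive1n k (fun x' => composition_density t x')) x 1 /\
    derive1n k (fun x' => composition_density t x') x =
    (quotient_numer (c *: ((t ^+ 3)%:P + t *: 'X^2)) ('X^4 + (t ^+ 4)%:P) k).[x] /
      (t ^+ 4 + x ^+ 4) ^+ k.+1.
  have -> : t ^+ 4 + x ^+ 4 = ('X^4 + (t ^+ 4)%:P).[x].
    by rewrite hornerD hornerXn hornerC addrC.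
  apply: (Dx _ _ k x I) => y _; rewrite (hornerD 'X^4) hornerXn hornerC (addrC (y ^+ 4)).
    exact: q0.
  by rewrite quotE// hornerZ hornerD hornerC hornerZ hornerXn.
split; [exact: int_tx|split; [exact: densE|split; [|split]]].
- by move=> k _; have [] := Dt k.
- by move=> k _; have [] := Dx k.
- have [_ ->] := Dt 4%N; have [_ ->] := Dx 4%N.
  by rewrite -mulrDl quartic_numer_cancel mul0r.
Qed.
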